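(* Let $\boldsymbol H\in\mathbb R^{m\times p}$ be a known matrix, let $s$ be a nonnegative integer with $s<p$, and assume $\operatorname{spark}(\boldsymbol H)>2s$. Let $\boldsymbol\alpha_0\in\mathcal T=\{\boldsymbol\alpha\in\mathbb R^p:\|\boldsymbol\alpha\|_0\le s\}$ be an unknown deterministic parameter, to be estimated from $\boldsymbol y=\boldsymbol H\boldsymbol\alpha_0+\boldsymbol w$, where $\boldsymbol w\in\mathbb R^m$ has i.i.d. Gaussian entries with mean zero and variance $\sigma^2>0$. Let $\widehat{\boldsymbol\alpha}$ be a finite-variance estimator of $\boldsymbol\alpha_0$, with bias gradient matrix $\boldsymbol B\in\mathbb R^{p\times p}$ at $\boldsymbol\alpha_0$. Then: (i) If $\|\boldsymbol\alpha_0\|_0<s$, then $\boldsymbol B$ must satisfy $\mathcal N(\boldsymbol H)\subseteq\mathcal N(\boldsymbol I+\boldsymbol B)$ (that is, no finite-variance estimator exists whose bias gradient at $\boldsymbol\alpha_0$ violates this inclusion). (ii) Any estimator whose $\mathcal T$-bias gradient matrix at $\boldsymbol\alpha_0$ is $\boldsymbol B\boldsymbol U$ has covariance at $\boldsymbol\alpha_0$ satisfying $$\operatorname{Cov}(\widehat{\boldsymbol\alpha})\succeq\sigma^2(\boldsymbol I+\boldsymbol B)(\boldsymbol H^T\boldsymbol H)^{\dagger}(\boldsymbol I+\boldsymbol B^T)\quad\text{when }\|\boldsymbol\alpha_0\|_0<s,$$ $$\operatorname{Cov}(\widehat{\boldsymbol\alpha})\succeq\sigma^2(\boldsymbol U+\boldsymbol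 B\boldsymbol U)(\boldsymbol H_{\boldsymbol\alpha_0}^T\boldsymbol H_{\boldsymbol\alpha_0})^{-1}(\boldsymbol U+\boldsymbol B\boldsymbol U)^T\quad\text{when }\|\boldsymbol\alpha_0\|_0=s.$$ Here $\boldsymbol H_{\boldsymbol\alpha_0}$ is the matrix consisting of the columns of $\boldsymbol H$ indexed by $\operatorname{supp}(\boldsymbol\alpha_0)$.
   Context: Notation: $\|\boldsymbol v\|_0$ is the number of nonzero entries of $\boldsymbol v$; $\operatorname{supp}(\boldsymbol v)$ is the set of indices of its nonzero entries; $\mathcal N(\boldsymbol M)$ is the null space and $\boldsymbol M^\dagger$ the Moore--Penrose pseudoinverse of $\boldsymbol M$; $\boldsymbol M_1\succeq\boldsymbol M_2$ means $\boldsymbol M_1-\boldsymbol M_2$ is positive semidefinite; $\boldsymbol e_j$ is the $j$th standard basis vector; $\boldsymbol I$ is the identity matrix. $\operatorname{spark}(\boldsymbol H)$ is the smallest integer $k$ such that there exist $k$ linearly dependent columns of $\boldsymbol H$ ($+\infty$ if there is none). An estimator is a (measurable) function $\widehat{\boldsymbol\alpha}=\widehat{\boldsymbol\alpha}(\boldsymbol y)\in\mathbb R^p$ of the measurements. For $\boldsymbol\alpha\in\mathbb R^p$, let $p(\boldsymbol y;\boldsymbol\alpha)$ be the density of $\boldsymbol y=\boldsymbol H\boldsymbol\alpha+\boldsymbol w$. The bias is $\boldsymbol b(\boldsymbol\alpha)=E\{\widehat{\boldsymbol\alpha}\}-\boldsymbol\alpha$, with expectation over $\boldsymbol y\sim p(\cdot;\boldsymbol\alpha)$,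 and the bias gradient matrix is $\boldsymbol B(\boldsymbol\alpha)=\partial\boldsymbol b/\partial\boldsymbol\alpha$, whose $ij$th entry is $\partial b_i/\partial\alpha_j$ (derivatives in all directions of $\mathbb R^p$); $\boldsymbol B$ denotes its value at $\boldsymbol\alpha_0$. $\operatorname{Cov}(\widehat{\boldsymbol\alpha})$ is the covariance matrix of $\widehat{\boldsymbol\alpha}$ under $p(\cdot;\boldsymbol\alpha_0)$, and finite-variance means that this covariance is finite. As a standing regularity assumption, integration with respect to $\boldsymbol y$ and differentiation with respect to the parameter can be interchanged, in particular in $E\{\widehat{\boldsymbol\alpha}\}=\int\widehat{\boldsymbol\alpha}(\boldsymbol y)\,p(\boldsymbol y;\boldsymbol\alpha)\,d\boldsymbol y$. The matrix $\boldsymbol U$ has as columns an orthonormal basis of the feasible subspace of $\mathcal T$ at $\boldsymbol\alpha_0$, i.e., of the span of the directions along which all sufficiently small movements from $\boldsymbol\alpha_0$ (in either sense) stay in $\mathcal T$. Concretely, $\boldsymbol U=\boldsymbol I$ (the $p\times p$ identity) when $\|\boldsymbol\alpha_0\|_0<s$, and $\boldsymbol U=[\boldsymbol e_{i_1},\ldots,\boldsymbol e_{i_s}]$ when $\|\boldsymbol\alpha_0\|_0=s$ and $\operatorname{supp}(\boldsymbol\alpha_0)=\{i_1,\ldots,i_s\}$ (the columns of $\boldsymbol H_{\boldsymbol\alpha_0}$ are taken in the same order $i_1,\dots,i_s$). The $\mathcal T$-bias gradient matrix of an estimator at $\boldsymbol\alpha_0$ is the product $\boldsymbol B\boldsymbol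 U$; in part (ii) only this product is prescribed and $\boldsymbol B$ is otherwise arbitrary. *)

(* Defs.v *)
From HB Require Import structures.
From mathcomp Require Import all_boot all_order all_algebra.
From mathcomp Require Import all_classical all_reals all_analysis.

Set Implicit Arguments.
Unset Strict Implicit.
Unset Printing Implicit Defensive.

Import Order.TTheory GRing.Theory Num.Theory.
Import numFieldNormedType.Exports.

Local Open Scope classical_set_scope.
Local Open Scope ring_scope.

(* Vectors on which matrices act are column vectors; measurements and
   estimates are tuples, since those carry the product sigma-algebra. *)

Section sparsity.
Context {R : realType}.

Definition supp (p : nat) (v : 'cV[R]_p) : {set 'I_p} := [set j | v j 0 != 0].

Definition norm0 (p : nat) (v : 'cV[R]_p) : nat := #|supp v|.

Definition sparse_vectors (p s : nat) : set 'cV[R]_p :=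
  [set a | (norm0 a <= s)%N].

(* The columns are counted with their indices, so two equal columns are
   linearly dependent; the infimum of the empty set is [+oo]. *)
Definition spark (m p : nat) (H : 'M[R]_(m, p)) : \bar R :=
  ereal_inf [set k%:R%:E | k in [set k : nat |
    exists2 A : {set 'I_p}, #|A| = k & ~~ free [seq col j H | j in A]]].

(* [H_A]: the columns of [H] indexed by [A], in increasing order. For
   [H := 1%:M] these are the standard basis vectors [e_j], [j \in A]. *)
Definition columns (m p : nat) (H : 'M[R]_(m, p)) (A : {set 'I_p}) :
    'M[R]_(m, #|A|) :=
  colsub enum_val H.

Definition null_space (m p : nat) (M : 'M[R]_(m, p)) : set 'cV[R]_p :=
  [set v | M *m v = 0].

Definition psdmx (n : nat) (M : 'M[R]_n) : Prop :=
  M^T = M /\ forall v : 'cV[R]_n, 0 <= (v^T *m M *m v) 0 0.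

Definition loewner_ge (n : nat) (M N : 'M[R]_n) : Prop := psdmx (M - N).

End sparsity.

Section pseudoinverse.
Context {R : realType}.

Definition penrose (m n : nat) (A : 'M[R]_(m, n)) (X : 'M[R]_(n, m)) : Prop :=
  [/\ A *m X *m A = A, X *m A *m X = X,
      (A *m X)^T = A *m X & (X *m A)^T = X *m A].

Definition pseudoinverse (m n : nat) (A : 'M[R]_(m, n)) : 'M[R]_(n, m) :=
  xget 0 [set X | penrose A X].

Lemma gram_unit (m n : nat) (B : 'M[R]_(m, n)) :
  row_free B -> B *m B^T \in unitmx.
Proof.
move=> fB; rewrite -row_free_unit -kermx_eq0.
apply/eqP/row_matrixP => i; rewrite row0.
set u := row i _.
have uG : u *m (B *m B^T) = 0.
  by apply/sub_kermxP; rewrite /u row_sub.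
have : (u *m B) *m (u *m B)^T = 0.
  by rewrite trmx_mul mulmxA -(mulmxA u) uG mul0mx.
move=> uB_norm0; apply: (row_free_inj fB); rewrite mul0mx.
move: (u *m B) uB_norm0 => v /matrixP /(_ 0 0); rewrite !mxE => /eqP.
rewrite psumr_eq0; last by move=> j _; rewrite mxE -expr2 sqr_ge0.
move=> /allP v0; apply/rowP => j; rewrite [RHS]mxE.
have := v0 j (mem_index_enum j).
by rewrite /= mxE -expr2 sqrf_eq0 => /eqP.
Qed.

Lemma pseudoinverseP (m n : nat) (A : 'M[R]_(m, n)) :
  penrose A (pseudoinverse A).
Proof.
rewrite /pseudoinverse.
suff [X pX] : exists X, penrose A X.
  exact: (@xgetPex _ 0 [set X | penrose A X]) (ex_intro _ X pX).
have uF : row_base A *m (row_base A)^T \in unitmx.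
  exact/gram_unit/row_base_free.
have uC : (col_base A)^T *m col_base A \in unitmx.
  rewrite -[X in _ *m X]trmxK; apply: gram_unit.
  by rewrite /row_free mxrank_tr; exact: col_base_full.
move: (mulmx_base A) uF uC.
move: (\rank A) (col_base A) (row_base A) => r C F AE uF uC.
set gF := F *m F^T in uF; set gC := C^T *m C in uC.
have sF : gF^T = gF by rewrite /gF trmx_mul trmxK.
have sC : gC^T = gC by rewrite /gC trmx_mul trmxK.
exists (F^T *m invmx gF *m invmx gC *m C^T).
have AX : A *m (F^T *m invmx gF *m invmx gC *m C^T) = C *m invmx gC *m C^T.
  by rewrite -AE -!mulmxA (mulmxA F) -/gF (mulmxA gF) mulmxV// mul1mx.
have XA : F^T *m invmx gF *m invmx gC *m C^T *m A = F^T *m invmx gF *m F.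
  by rewrite -AE -!mulmxA (mulmxA C^T) -/gC (mulmxA _ gC) mulVmx// mul1mx.
split.
- by rewrite AX -AE -!mulmxA (mulmxA C^T) -/gC (mulmxA _ gC) mulVmx// mul1mx.
- by rewrite XA -!mulmxA (mulmxA F) -/gF (mulmxA gF) mulmxV// mul1mx.
- by rewrite AX !trmx_mul trmxK trmx_inv sC mulmxA.
- by rewrite XA !trmx_mul trmxK trmx_inv sF mulmxA.
Qed.

Lemma penrose_inj (m n : nat) (A : 'M[R]_(m, n)) (X Y : 'M[R]_(n, m)) :
  penrose A X -> penrose A Y -> X = Y.
Proof.
move=> [x1 x2 x3 x4] [y1 y2 y3 y4].
have AXY : A *m X = A *m Y.
  rewrite -x3 -{1}y1 -[A *m Y *m A *m X]mulmxA trmx_mul x3 y3.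
  by rewrite mulmxA x1.
have XAY : X *m A = Y *m A.
  rewrite -x4 -{1}y1 -[A *m Y *m A]mulmxA mulmxA trmx_mul x4 y4.
  by rewrite -mulmxA [A *m (X *m A)]mulmxA x1.
by rewrite -x2 -mulmxA AXY mulmxA XAY y2.
Qed.

End pseudoinverse.

Section lebesgue_measure_tuple.
Context {R : realType}.

Definition cons_pair (n : nat) (z : measurableTypeR R * n.-tuple R) :
    n.+1.-tuple R :=
  [tuple of (z.1 : R) :: z.2].

Lemma measurable_cons_pair (n : nat) :
  measurable_fun [set: measurableTypeR R * n.-tuple R] (@cons_pair n).
Proof.
apply: (@measurable_cons _ _ _ R (fun z => z.1 : R) n (fun z => z.2)).
  by move=> _ A mA; exact: measurable_fst.
exact: measurable_snd.
Qed.

Section step.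
Variables (n : nat) (mu : {sigma_finite_measure set (n.-tuple R) -> \bar R}).

Definition lebesgue_tuple_step : set (n.+1.-tuple R) -> \bar R :=
  pushforward (lebesgue_measure \x mu)%E (@cons_pair n).

Let step0 : lebesgue_tuple_step set0 = 0%E.
Proof. by rewrite /lebesgue_tuple_step /pushforward preimage_set0 measure0. Qed.

Let step_ge0 A : (0 <= lebesgue_tuple_step A)%E.
Proof. by apply: (@measure_ge0 _ _ _ (lebesgue_measure \x mu)%E). Qed.

Let step_sigma_additive : semi_sigma_additive lebesgue_tuple_step.
Proof.
exact: (@measure_semi_sigma_additive _ _ _
  (measure_function_pushforward__canonical__measure_function_Measure
    (lebesgue_measure \x mu)%E (@measurable_cons_pair n))).
Qed.

HB.instance Definition _ := isMeasure.Build _ _ _ lebesgue_tuple_step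
  step0 step_ge0 step_sigma_additive.

Let step_sigma_finite : sigma_finite [set: n.+1.-tuple R] lebesgue_tuple_step.
Proof.
have /sigma_finiteP[F [FT ndF Foo]] := sigma_finiteT (@lebesgue_measure R).
have /sigma_finiteP[G [GT ndG Goo]] := sigma_finiteT mu.
pose split (t : n.+1.-tuple R) : measurableTypeR R * n.-tuple R :=
  (thead t, [tuple of behead t]).
have msplit : measurable_fun [set: n.+1.-tuple R] split.
  apply/measurable_fun_pairP; split.
    exact: (@measurable_tnth _ R n.+1 ord0).
  exact: measurable_behead.
have cK t : cons_pair (split t) = t by rewrite /cons_pair [RHS]tuple_eta.
have sK z : split (cons_pair z) = z.
  case: z => x t; rewrite /split /cons_pair theadE /=.
  by congr pair; apply/val_inj.
exists (fun k => split @^-1` (F k `*` G k)).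
  apply/seteqP; split=> // t _.
  have [i _ Fi] : (\bigcup_k F k) (split t).1 by rewrite -FT.
  have [j _ Gj] : (\bigcup_k G k) (split t).2 by rewrite -GT.
  exists (maxn i j) => //; split.
    by move: Fi; exact/subsetPset/ndF/leq_maxl.
  by move: Gj; exact/subsetPset/ndG/leq_maxr.
move=> k; have [mF Fk] := Foo k; have [mG Gk] := Goo k; split.
  by rewrite -[X in measurable X]setTI; apply: msplit => //; exact: measurableX.
rewrite /lebesgue_tuple_step /pushforward -comp_preimage.
rewrite (_ : split \o _ = id); last exact/funext.
by rewrite preimage_id product_measure1E// lte_mul_pinfty// ge0_fin_numE.
Qed.

HB.instance Definition _ := Measure_isSigmaFinite.Build _ _ _
  lebesgue_tuple_step step_sigma_finite.

End step.

(* Lebesgue measure on R^n, as an iterated product measure. *)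
Fixpoint lebesgue_tuple (n : nat) :
    {sigma_finite_measure set (n.-tuple R) -> \bar R} :=
  match n with
  | 0 => \d_([tuple] : 0.-tuple R)
  | n'.+1 => lebesgue_tuple_step (lebesgue_tuple n')
  end.

End lebesgue_measure_tuple.

Section linear_gaussian_model.
Context {R : realType} {m p : nat}.

(* The density of [H *m a + w] with respect to Lebesgue measure, for [w] with
   independent N(0, sigma^2) entries; the second parameter of [normal_pdf] and
   of [normal_prob] is the standard deviation. *)
Definition density (H : 'M[R]_(m, p)) (sigma : R) (y : m.-tuple R)
    (a : 'cV[R]_p) : R :=
  \prod_(i < m) normal_pdf ((H *m a) i 0) sigma (tnth y i).

(* Integration over the measurements and partial differentiation with respect
   to the parameter can be interchanged at [a] in each entry of
   [\int est(y) p(y; a) dy]; this includes the existence of the derivatives. *)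
Definition regular_estimator (H : 'M[R]_(m, p)) (sigma : R)
    (est : {mfun m.-tuple R >-> p.-tuple R}) (a : 'cV[R]_p) : Prop :=
  forall i j : 'I_p,
    let e_j : 'cV[R]_p := delta_mx j 0 in
    let mean_i (b : 'cV[R]_p) : R :=
      \int[lebesgue_tuple m]_y (tnth (est y) i * density H sigma y b) in
    derivable mean_i a e_j /\
    'D_e_j mean_i a =
      \int[lebesgue_tuple m]_y (tnth (est y) i * 'D_e_j (density H sigma y) a).

Context {d : measure_display} {Omega : measurableType d}
  {P : probability Omega R}.

(* The product rule for a subfamily is the case where the other [A i] are
   [setT]. *)
Definition mutually_independent (w : 'I_m -> {RV P >-> R}) : Prop :=
  forall A : 'I_m -> set R, (forall i, measurable (A i)) ->
    P (\bigcap_(i in [set: 'I_m]) (w i @^-1` A i)) =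
    (\prod_(i < m) P (w i @^-1` A i))%E.

Definition iid_gaussian (w : 'I_m -> {RV P >-> R}) (sigma : R) : Prop :=
  mutually_independent w /\
  forall (i : 'I_m) (A : set R), measurable A ->
    distribution P (w i) A = normal_prob 0 sigma A.

Definition measurements (H : 'M[R]_(m, p)) (w : 'I_m -> {RV P >-> R})
    (a : 'cV[R]_p) (omega : Omega) : m.-tuple R :=
  [tuple (H *m a) i 0 + w i omega | i < m].

Variables (H : 'M[R]_(m, p)) (w : 'I_m -> {RV P >-> R})
  (est : {mfun m.-tuple R >-> p.-tuple R}).

Definition estimate (a : 'cV[R]_p) (i : 'I_p) (omega : Omega) : R :=
  tnth (est (measurements H w a omega)) i.

Definition bias (a : 'cV[R]_p) : 'cV[R]_p :=
  (\col_i fine 'E_P[estimate a i]) - a.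

Definition bias_gradient (a : 'cV[R]_p) : 'M[R]_p :=
  \matrix_(i, j) 'D_(delta_mx j 0) (fun b => bias b i 0 : R) a.

Definition finite_variance (a : 'cV[R]_p) : Prop :=
  forall i j, covariance P (estimate a i) (estimate a j) \is a fin_num.

Definition cov_mx (a : 'cV[R]_p) : 'M[R]_p :=
  \matrix_(i, j) fine (covariance P (estimate a i) (estimate a j)).

End linear_gaussian_model.

(* Main.v *)
From HB Require Import structures.
Require Import Defs.
From mathcomp Require Import all_boot all_order all_algebra.
From mathcomp Require Import all_classical all_reals all_analysis.
From mathcomp Require Import measurable_realfun ring lra.

Set Implicit Arguments.
Unset Strict Implicit.
Unset Printing Implicit Defensive.

Import Order.TTheory GRing.Theory Num.Theory.
Import numFieldNormedType.Exports.

Local Open Scope classical_set_scope.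
Local Open Scope ring_scope.

(** The estimate is compared with the linear combinations [u . w] of the noise.
    Write [X] for the estimate at [alpha0], [C] for its covariance matrix with
    the noise vector [w], and [B0] for its bias gradient.

    The measurements [H a + w] have the density of the model with respect to
    Lebesgue measure: both laws give the same mass to boxes.  Hence the mean of
    the estimator at [a] is the integral of the estimator against
    [density H sigma . a], and interchanging integral and derivative expresses
    its derivative along [v] as the mean of the estimator times the score.  At
    the measurements the score along [v] is [(w . H v) / sigma^2], and [w] is
    centred, so that
    [1 + B0 = sigma^-2 C H]                        ([bias_gradient_noise_cov]).
    Part (i) follows at once, since [H v = 0] forces [(1 + B0) v = 0].

    For part (ii), [0 <= V(v . X - u . w)] together with
    [V(u . w) <= sigma^2 |u|^2] gives
    [2 v^T C u - sigma^2 |u|^2 <= v^T Cov v]       ([covariance_noise_bound])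
    for all [v] and [u].  When [M = H], or [M] consists of the columns of [H] in
    the support of [alpha0], and [G] is the pseudoinverse, respectively the
    inverse, of [M^T M], the choice [u = sigma^-2 M G M^T C^T v] turns this into
    [Cov >= sigma^-2 C M G M^T C^T]                ([loewner_ge_projection]),
    and [sigma^-2 C M] is [1 + B0], respectively [(1 + B0) U], so this is the
    claimed bound.  In the second case [M^T M] is invertible because the spark
    of [H] exceeds the size of the support.

    The moments of [u . w] are obtained without computing any correlation: a
    translation of the Gaussian density multiplies it by an exponential of a
    linear function, so that [E exp(t u . w) = exp(t^2 sigma^2 |u|^2 / 2)], and
    the behaviour of this identity for small [t] gives [E (u . w) = 0] and
    [E (u . w)^2 <= sigma^2 |u|^2], which is all that is needed. *)

(** * Product integrals and translated Gaussian laws *)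

Section lebesgue_tuple_product.
Context {R : realType}.
Local Open Scope ereal_scope.

Lemma measurable_fun_prode d (T : measurableType d) (n : nat)
    (f : 'I_n -> T -> \bar R) :
  (forall i, measurable_fun setT (f i)) ->
  measurable_fun setT (fun x => \prod_(i < n) f i x).
Proof.
elim: n f => [|n IH] f mf.
  by apply: eq_measurable_fun (measurable_cst 1) => x _; rewrite big_ord0.
apply: (@eq_measurable_fun _ _ _ _ _
  (fun x => f ord0 x * \prod_(i < n) f (lift ord0 i) x)).
  by move=> x _; rewrite big_ord_recl.
by apply: emeasurable_funM => //; exact: IH.
Qed.

(** Tonelli's theorem for products of functions of the separate coordinates. *)
Lemma integral_lebesgue_tuple_prod (n : nat) (f : 'I_n -> R -> \bar R) :
  (forall i, measurable_fun setT (f i)) -> (forall i x, 0 <= f i x) ->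
  \int[lebesgue_tuple n]_t \prod_(i < n) f i (tnth t i) =
  \prod_(i < n) \int[@lebesgue_measure R]_x f i x.
Proof.
elim: n f => [|n IH] f mf f0.
  rewrite big_ord0 /= integral_dirac//.
    by rewrite diracT mul1e big_ord0.
  by apply: eq_measurable_fun (measurable_cst 1) => x _; rewrite big_ord0.
have mF k (g : 'I_k -> R -> \bar R) : (forall i, measurable_fun setT (g i)) ->
    measurable_fun setT (fun t : k.-tuple R => \prod_(i < k) g i (tnth t i)).
  move=> mg; apply: (@measurable_fun_prode _ (k.-tuple R) k (fun i t => g i (tnth t i))) => i.
  exact: (measurableT_comp (mg i) (measurable_tnth i)).
have p0 (t : n.+1.-tuple R) : 0 <= \prod_(i < n.+1) f i (tnth t i).
  by apply: prode_ge0.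
rewrite [LHS](@ge0_integral_pushforward _ _ _ _ R _ (@measurable_cons_pair R n)
  (lebesgue_measure \x lebesgue_tuple n) setT) //=; last exact: mF.
rewrite preimage_setT.
rewrite fubini_tonelli1//; last first.
  exact: (measurableT_comp (mF _ _ mf) (@measurable_cons_pair R n)).
rewrite big_ord_recl -IH//.
rewrite -ge0_integralZr//.
- apply: eq_integral => x _; rewrite /fubini_F /=.
  rewrite -ge0_integralZl//.
  + apply: eq_integral => t _; rewrite big_ord_recl; congr (_ * _).
    by apply: eq_bigr => i _; rewrite tnthS; congr (f _ (tnth _ _)); exact: val_inj.
  + exact: (mF n (fun i => f (lift ord0 i))).
  + by move=> t _; apply: prode_ge0.
- exact: mf.
- by apply: integral_ge0 => t _; apply: prode_ge0.
Qed.

End lebesgue_tuple_product.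

Section normal_translation.
Context {R : realType}.
Local Open Scope ereal_scope.

Lemma lebesgue_measure_shift (c : R) (A : set R) : measurable A ->
  pushforward lebesgue_measure (+%R c : _ -> measurableTypeR R) A = lebesgue_measure A.
Proof.
have mc : measurable_fun [set: measurableTypeR R] (+%R c : _ -> measurableTypeR R).
  exact: measurable_funD.
move=> mA; apply/esym.
apply: (lebesgue_measure_unique (mu := (measure_function_pushforward__canonical__measure_function_Measure
    lebesgue_measure mc))) => //= _ [[a b]] _ <-.
rewrite /pushforward.
have -> : +%R c @^-1` `]a, b]%classic = `](a - c)%R, (b - c)%R]%classic.
  by apply/seteqP; split => x /=; rewrite !in_itv/= ltrBlDl lerBrDl.
rewrite !lebesgue_measure_itv/= !lte_fin ltrD2r.
by case: ifP => // _; rewrite -!EFinB; congr (_%:E); ring.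
Qed.

(** The hypothesis excludes the degenerate case, where [normal_prob] is by
    convention the uniform law on [0, 1] whatever the mean. *)
Lemma normal_prob_shift (c s : R) (A : set R) : s != 0%R -> measurable A ->
  normal_prob 0 s (+%R c @^-1` A) = normal_prob c s A.
Proof.
move=> s0 mA; rewrite /normal_prob.
have mc : measurable_fun [set: measurableTypeR R] (+%R c : _ -> measurableTypeR R).
  exact: measurable_funD.
have mp : measurable_fun A (EFin \o normal_pdf c s).
  by apply/measurable_EFinP/measurable_funTS; exact: measurable_normal_pdf.
rewrite [RHS](eq_measure_integral
    (pushforward lebesgue_measure (+%R c : _ -> measurableTypeR R))); last first.
  by move=> B mB _; rewrite /= lebesgue_measure_shift.
rewrite [RHS](ge0_integral_pushforward
    (phi := +%R c : measurableTypeR R -> measurableTypeR R)) //=; last first.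
  by move=> x _; rewrite lee_fin normal_pdf_ge0.
apply: eq_integral => x _ /=; congr (_%:E).
by rewrite !normal_pdfE// /normal_fun subr0 addrAC subrr add0r.
Qed.
End normal_translation.

(** * The law of the measurements *)

Section weighted_measure.
Context d (T : measurableType d) (R : realType).
Variables (mu : {sigma_finite_measure set T -> \bar R}) (phi : T -> R).
Hypotheses (mphi : measurable_fun setT phi) (phi0 : forall x, 0 <= phi x).
Hypothesis phi1 : (\int[mu]_x (phi x)%:E = 1)%E.
Local Open Scope ereal_scope.

(** The measure with density [phi] with respect to [mu]. *)
Definition weighted_measure (A : set T) : \bar R := \int[mu]_(x in A) (phi x)%:E.

Let mphiE (A : set T) : measurable_fun A (EFin \o phi).
Proof. exact/measurable_EFinP/measurable_funTS. Qed.

Lemma integrable_weight : mu.-integrable setT (EFin \o phi).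
Proof.
apply/integrableP; split; first exact: mphiE.
under eq_integral do rewrite /= ger0_norm//.
by rewrite phi1 ltry.
Qed.

Let weighted0 : weighted_measure set0 = 0.
Proof. exact: integral_set0. Qed.

Let weighted_ge0 A : 0 <= weighted_measure A.
Proof. by apply: integral_ge0 => x _; rewrite lee_fin. Qed.

Let weighted_sigma_additive : semi_sigma_additive weighted_measure.
Proof.
move=> /= F mF tF mUF; rewrite /weighted_measure integral_bigcup//=; last first.
  by apply: (integrableS _ _ (subsetT _)) => //; exact: integrable_weight.
apply: is_cvg_ereal_nneg_natsum_cond => n _ _.
by apply: integral_ge0 => /= x ?; rewrite lee_fin.
Qed.

HB.instance Definition _ := isMeasure.Build _ _ _ weighted_measure
  weighted0 weighted_ge0 weighted_sigma_additive.

Let weighted_setT : weighted_measure [set: _] = 1.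
Proof. exact: phi1. Qed.

HB.instance Definition _ :=
  @Measure_isProbability.Build _ _ R weighted_measure weighted_setT.

(** The same measure, bundled as a probability since [phi] integrates to 1. *)
Definition weighted_probability : probability T R := weighted_measure.

Lemma weighted_measure_dominates : weighted_measure `<< mu.
Proof.
apply/null_content_dominatesP => A mA A0; exact: null_set_integral.
Qed.

Lemma ge0_integral_weighted_measure (g : T -> \bar R) :
  measurable_fun setT g -> (forall x, 0 <= g x) ->
  \int[weighted_probability]_x g x = \int[mu]_x (g x * (phi x)%:E).
Proof.
move=> mg g0.
(* [phi] is almost everywhere the Radon-Nikodym derivative of its measure *)
rewrite -(Radon_Nikodym_SigmaFinite.change_of_variables weighted_measure_dominates)//.
have intf := Radon_Nikodym_SigmaFinite.f_integrable weighted_measure_dominates.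
apply: ae_eq_integral => //.
- by apply: emeasurable_funM => //; exact: measurable_int intf.
- by apply: emeasurable_funM => //; exact: mphiE.
- apply: ae_eqe_mul2l; apply: integral_ae_eq => // E _ mE.
  by rewrite -Radon_Nikodym_SigmaFinite.f_integral//; exact: weighted_measure_dominates.
Qed.

End weighted_measure.

Section density.
Context {R : realType} {m p : nat}.
Variables (H : 'M[R]_(m, p)) (sigma : R).

Lemma density_ge0 y a : 0 <= density H sigma y a.
Proof. by apply: prodr_ge0 => i _; exact: normal_pdf_ge0. Qed.

Lemma measurable_density a : measurable_fun setT (density H sigma ^~ a).
Proof.
rewrite /density; apply: measurable_prod => i _.
exact: (measurableT_comp (measurable_normal_pdf _ _) (measurable_tnth i)).
Qed.

Lemma integral_density_box a (A : 'I_m -> set R) : (forall i, measurable (A i)) ->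
  (\int[lebesgue_tuple m]_(y in [set y | forall i, A i (tnth y i)])
      (density H sigma y a)%:E
  = \prod_(i < m) normal_prob ((H *m a) i 0)%R sigma (A i))%E.
Proof.
move=> mA.
rewrite integral_mkcond.
pose f i x := ((normal_pdf ((H *m a) i 0)%R sigma x)%:E * (\1_(A i) x)%:E)%E.
transitivity (\int[lebesgue_tuple m]_t \prod_(i < m) f i (tnth t i))%E.
  apply: eq_integral => y _; rewrite epatch_indic /density -prodEFin.
  rewrite big_split /=; congr (_ * _)%E.
  rewrite prodEFin; congr (_%:E).
  have [yA|yA] := boolP (y \in [set y | forall i, A i (tnth y i)]).
    rewrite indicE yA big1// => i _; rewrite indicE mem_set//.
    by move/set_mem : yA; exact.
  rewrite indicE (negbTE yA); apply/esym/eqP/prodf_eq0.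
  move: yA; rewrite notin_setE => /existsNP[i Ai]; exists i => //.
  by rewrite indicE memNset.
rewrite integral_lebesgue_tuple_prod//.
- apply: eq_bigr => i _; rewrite /normal_prob [RHS]integral_mkcond.
  by apply: eq_integral => x _; rewrite epatch_indic.
- move=> i; apply: emeasurable_funM; apply/measurable_EFinP.
    exact: measurable_normal_pdf.
  exact: measurable_indic.
- by move=> i x; rewrite mule_ge0 ?lee_fin ?normal_pdf_ge0.
Qed.

Lemma integral_density a : (\int[lebesgue_tuple m]_y (density H sigma y a)%:E = 1)%E.
Proof.
have := @integral_density_box a (fun=> setT) (fun=> measurableT).
rewrite (_ : [set y | _] = setT); last by apply/seteqP; split.
by move=> ->; rewrite big1// => i _; rewrite probability_setT.
Qed.

End density.

Lemma measurable_tuple_box (R : realType) (m : nat) (A : 'I_m -> set R) :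
  (forall i, measurable (A i)) ->
  measurable [set y : m.-tuple R | forall i, A i (tnth y i)].
Proof.
move=> mA.
rewrite (_ : [set y | _] = \bigcap_(i in [set: 'I_m]) ((@tnth m R ^~ i) @^-1` A i)).
  apply: fin_bigcap_measurable => // i _.
  by rewrite -[X in measurable X]setTI; exact: measurable_tnth.
by apply/seteqP; split => y /= yA i; [move=> _|]; exact: yA.
Qed.

(** Boxes form a generating pi-system. *)
Lemma tuple_measure_unique (R : realType) (m : nat)
    (mu nu : {measure set (m.-tuple R) -> \bar R}) :
  (mu setT < +oo)%E ->
  (forall A : 'I_m -> set R, (forall i, measurable (A i)) ->
    mu [set y | forall i, A i (tnth y i)] = nu [set y | forall i, A i (tnth y i)]) ->
  forall E, measurable E -> mu E = nu E.
Proof.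
move=> muoo munu.
pose box (A : 'I_m -> set R) := [set y : m.-tuple R | forall i, A i (tnth y i)].
pose G := [set B | exists2 A : 'I_m -> set R, (forall i, measurable (A i)) & B = box A].
have GT : G setT by exists (fun=> setT) => //; apply/seteqP; split.
have key : forall E, <<s G >> E -> mu E = nu E.
  apply: (g_sigma_algebra_measure_unique G _ (fun=> setT)).
  - by move=> B [A mA ->]; exact: measurable_tuple_box.
  - by [].
  - by rewrite bigcup_const.
  - move=> _ _ [A mA ->] [B mB ->]; exists (fun i => A i `&` B i).
      by move=> i; exact: measurableI.
    apply/seteqP; split => y /=; first by move=> [yA yB] i; split; [exact: yA|exact: yB].
    by move=> yAB; split => i; case: (yAB i).
  - by move=> B [A mA ->]; exact: munu.
  - by [].
move=> E mE; apply: key; move: E mE.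
apply: smallest_sub; first exact: smallest_sigma_algebra.
(* the generators of the product sigma-algebra are boxes with all sides but one
   equal to [setT]; for [m = 0] there is none *)
case: m => [|n] in mu nu muoo munu box G GT *; first by rewrite big_ord0.
rewrite -bigcup_mkord_ord; apply: bigcup_sub => i Ii _ [B mB <-].
apply: sub_sigma_algebra.
exists (fun j => if j == inord i then B else setT); first by move=> j; case: ifP.
rewrite setTI; apply/seteqP; split => y /=.
  by move=> By j; case: ifP => // /eqP ->.
by move=> /(_ (inord i)); rewrite eqxx.
Qed.

Section measurements_law.
Context {R : realType} {m p : nat} {d : measure_display} {Omega : measurableType d}
  {P : probability Omega R}.
Variables (H : 'M[R]_(m, p)) (sigma : R) (w : 'I_m -> {RV P >-> R}).
Hypotheses (sigma0 : sigma != 0) (iidw : iid_gaussian w sigma).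

Lemma measurable_measurements a : measurable_fun setT (measurements H w a).
Proof.
apply/measurable_fun_tnthP => i.
rewrite (_ : _ \o _ = fun omega => (H *m a) i 0 + w i omega).
  by apply: measurable_funD.
by apply/funext => omega; rewrite /= tnth_mktuple.
Qed.

HB.instance Definition _ a :=
  isMeasurableFun.Build _ _ _ _ (measurements H w a) (measurable_measurements a).

Lemma measurements_law a (A : set (m.-tuple R)) : measurable A ->
  distribution P (measurements H w a) A =
  weighted_probability (measurable_density H sigma a)
    ((density_ge0 H sigma)^~ a) (integral_density H sigma a) A.
Proof.
have [indw laww] := iidw.
move: A; apply: tuple_measure_unique => // [|B mB].
  apply: (@le_lt_trans _ _ 1%E); last exact: ltry.
  exact: (@probability_le1 _ _ _ (distribution P (measurements H w a))).
rewrite /= /weighted_measure integral_density_box//.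
rewrite (eq_bigr (fun i => P (w i @^-1` (+%R ((H *m a) i 0) @^-1` B i)))).
  rewrite -indw; last first.
    move=> i; rewrite -[X in measurable X]setTI.
    by apply: measurable_funD.
  congr (P _); apply/seteqP; split => omega /=.
    by move=> yB i _; have := yB i; rewrite tnth_mktuple.
  by move=> yB i; rewrite tnth_mktuple; exact: yB.
move=> i _; rewrite -normal_prob_shift// -(laww i)//.
rewrite -[X in measurable X]setTI.
by apply: measurable_funD.
Qed.

Lemma ge0_expectation_measurements a (g : m.-tuple R -> \bar R) :
  measurable_fun setT g -> (forall y, 0 <= g y)%E ->
  (\int[P]_omega g (measurements H w a omega) =
   \int[lebesgue_tuple m]_y (g y * (density H sigma y a)%:E))%E.
Proof.
move=> mg g0.
rewrite -(ge0_integral_weighted_measure (measurable_density H sigma a)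
    ((density_ge0 H sigma)^~ a) (integral_density H sigma a))//.
rewrite -(ge0_integral_distribution (measurements H w a))//.
by apply: eq_measure_integral => // A mA _; exact: measurements_law.
Qed.

(** No integrability is assumed: when one side is infinite or undefined, so is
    the other, with the same conventional value. *)
Lemma expectation_measurements a (g : m.-tuple R -> R) : measurable_fun setT g ->
  (\int[P]_omega (g (measurements H w a omega))%:E =
   \int[lebesgue_tuple m]_y (g y * density H sigma y a)%:E)%E.
Proof.
move=> mg.
rewrite integralE [RHS]integralE; congr (_ - _)%E.
- transitivity (\int[P]_omega (EFin \o g)^\+ (measurements H w a omega))%E.
    by apply: eq_integral => omega _; rewrite !funeposE.
  rewrite ge0_expectation_measurements//; last first.
    by apply/measurable_funepos/measurable_EFinP.
  apply: eq_integral => y _.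
  by rewrite !funeposE/= maxe_pMl ?mul0e ?lee_fin ?density_ge0.
- transitivity (\int[P]_omega (EFin \o g)^\- (measurements H w a omega))%E.
    by apply: eq_integral => omega _; rewrite !funenegE.
  rewrite ge0_expectation_measurements//; last first.
    by apply/measurable_funeneg/measurable_EFinP.
  apply: eq_integral => y _.
  by rewrite !funenegE/= maxe_pMl ?lee_fin ?density_ge0// mul0e -EFinM mulNr.
Qed.

End measurements_law.

(** * Moments from bounds on the moment generating function *)

Section real_inequalities.
Context {R : realType}.

Lemma expR_ge1DxD2 (x : R) : 0 <= x -> 1 + x + x ^+ 2 / 2 <= expR x.
Proof.
move=> x0.
have -> : 1 + x + x ^+ 2 / 2 = series (exp_coeff x) 3.
  rewrite /series /= !big_nat_recr//= big_geq// /exp_coeff/= add0r expr0 expr1.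
  by rewrite !divr1.
apply: nondecreasing_cvgn_le; last exact: is_cvg_series_exp_coeff.
by apply: nondecreasing_series => n _ _; rewrite /exp_coeff/= divr_ge0// exprn_ge0.
Qed.

Lemma sqr_le_expRD (z : R) : z ^+ 2 + 2 <= expR z + expR (- z).
Proof.
(* with [y = z / 2], the difference of the two sides is
   [(e^y - e^-y)^2 - (2 y)^2] *)
wlog z0 : z / 0 <= z.
  move=> h; have [/h//|/ltW z0] := leP 0 z.
  by have := h (- z); rewrite sqrrN opprK addrC oppr_ge0 => /(_ z0); lra.
set y := z / 2; have y0 : 0 <= y by rewrite divr_ge0.
have e0 : 0 < expR y by exact: expR_gt0.
have ey := expR_ge1DxD2 y0.
have -> : z = y + y by rewrite /y; lra.
rewrite opprD !expRD expRN.
set e := expR y in e0 ey *.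
have h : 2 * y <= e - e^-1.
  have : (2 * y) * e <= e * e - 1.
    suff : 0 <= (e - y) ^+ 2 - y ^+ 2 - 1 by lra.
    have : (1 + y ^+ 2 / 2) ^+ 2 <= (e - y) ^+ 2.
      have q0 : 0 <= y ^+ 2 by exact: sqr_ge0.
      rewrite ler_pXn2r// ?nnegrE; lra.
    have : 0 <= (y ^+ 2) ^+ 2 by exact: sqr_ge0.
    lra.
  by rewrite -ler_pdivlMr// mulrBl mulfK ?gt_eqF// mul1r.
have ee : e * e^-1 = 1 by rewrite divff ?gt_eqF.
have : (2 * y) ^+ 2 <= (e - e^-1) ^+ 2.
  by rewrite ler_pXn2r// ?nnegrE; lra.
by lra.
Qed.

Lemma expRB1_le (x : R) : (expR x - 1) * (1 - x) <= x.
Proof.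
have h : expR x * (1 - x) <= 1.
  by rewrite -[leRHS](expRxMexpNx_1 x) ler_pM2l ?expR_gt0 ?expR_ge1Dx.
lra.
Qed.

(** The right-hand side is [t^2 K] to leading order when [t] is small. *)
Lemma second_moment_le (M K : R) : 0 <= K ->
  (forall t, t ^+ 2 * M <= 2 * (expR (t ^+ 2 * K / 2) - 1)) -> M <= K.
Proof.
move=> K0 hM; rewrite leNgt; apply/negP => KM.
have M0 : 0 < M by exact: le_lt_trans KM.
have [K00|K00] := eqVneq K 0.
  by have := hM 1; rewrite K00 mulr0 mul0r expR0; lra.
have Kp : 0 < K by rewrite lt_def K00.
(* [t^2 = s] is small enough for [M (1 - t^2 K / 2) <= K] to fail *)
pose s := (M - K) / (M * K).
have s0 : 0 < s by rewrite divr_gt0 ?mulr_gt0 ?subr_gt0.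
have sE : s * (M * K) = M - K by rewrite divfK// gt_eqF ?mulr_gt0.
have := hM (Num.sqrt s); rewrite sqr_sqrtr ?(ltW s0)// => h.
have xM : s * K / 2 < 1 by rewrite -(ltr_pM2l M0); lra.
have := @expRB1_le (s * K / 2).
have : (s * M) * (1 - s * K / 2) <= 2 * (expR (s * K / 2) - 1) * (1 - s * K / 2).
  by rewrite ler_wpM2r// subr_ge0 ltW.
move=> h1 h2.
have : s * M * (1 - s * K / 2) <= s * K by lra.
rewrite -mulrA ler_pM2l//.
have : M * (1 - s * K / 2) = M - (M - K) / 2 by rewrite -sE; lra.
lra.
Qed.

(** The left-hand side is linear in [t], the right-hand side quadratic. *)
Lemma first_moment_le0 (e K : R) : 0 <= K ->
  (forall t, t * e <= expR (t ^+ 2 * K / 2) - 1) -> e <= 0.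
Proof.
move=> K0 he; rewrite leNgt; apply/negP => e0.
(* [t] is so small that [t K < e] and [t^2 K <= 1], whence the contradiction
   [t e <= t^2 K < t e] *)
have K1 : 0 < 1 + K + e by lra.
pose t := e / (1 + K + e) ^+ 2.
have d0 : 0 < (1 + K + e) ^+ 2 by rewrite exprn_gt0.
have t0 : 0 < t by rewrite divr_gt0.
have tE : t * (1 + K + e) ^+ 2 = e by rewrite divfK// gt_eqF.
have tK : t * K < e by rewrite -[ltRHS]tE ltr_pM2l//; nra.
have t1 : t <= 1 by rewrite -(ler_pM2r d0) tE; nra.
have h := he t; have hx := expRB1_le (t ^+ 2 * K / 2).
have te : t * (t * K) < t * e by rewrite ltr_pM2l.
have x0 : t ^+ 2 * K <= 1.
  have -> : t ^+ 2 * K = t * (t * K) by ring.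
  have := tE; nra.
have h1 : t * e * (1 - t ^+ 2 * K / 2) <= t ^+ 2 * K / 2.
  by apply: le_trans hx; rewrite ler_wpM2r//; lra.
have h2 : t * e * 2^-1 <= t * e * (1 - t ^+ 2 * K / 2).
  by rewrite ler_wpM2l//; [rewrite mulr_ge0// ltW|lra].
lra.
Qed.
End real_inequalities.

(** * The score of the Gaussian model *)

(** Along a line, the Gaussian density has this form. *)
Lemma is_derive_expR_quadratic (R : realType) (D S c : R) :
  is_derive (0 : R) (1 : R) (fun t => D * expR (t * S - t ^+ 2 * c)) (S * D).
Proof.
pose q : R -> R := S *: id - c *: (id * id).
have dq : is_derive (0 : R) (1 : R) q S.
  have := is_deriveB (is_deriveZ S (is_derive_id (0 : R) (1 : R)))
    (is_deriveZ c (is_deriveM (is_derive_id (0 : R) (1 : R))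
                              (is_derive_id (0 : R) (1 : R)))).
  by rewrite !scale0r addr0 scaler0 subr0 [S *: 1]mulr1.
have q0 : q 0 = 0 by rewrite /q !fctE mul0r !scaler0 subr0.
have -> : (fun t => D * expR (t * S - t ^+ 2 * c)) = D *: (expR \o q).
  apply/funext => t.
  have E : t * S - t ^+ 2 * c = S * t - c * (t * t) by ring.
  by rewrite E.
have h := is_deriveZ D (is_derive1_comp (is_derive_expR (q 0)) dq).
rewrite q0 expR0 mul1r [D *: S]mulrC in h.
exact: h.
Qed.

Section density_directions.
Context {R : realType} {m p : nat}.
Variables (H : 'M[R]_(m, p)) (sigma : R).
Hypothesis sigma0 : sigma != 0.

(** A translation of the parameter multiplies the density by the exponential of
    an affine function of the measurements. *)
Lemma density_shift (y : m.-tuple R) (a v : 'cV[R]_p) :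
  density H sigma y (v + a) = density H sigma y a *
    expR (\sum_(i < m) (tnth y i - (H *m a) i 0) * (H *m v) i 0 / sigma ^+ 2 -
          \sum_(i < m) ((H *m v) i 0) ^+ 2 / (sigma ^+ 2 *+ 2)).
Proof.
rewrite -sumrB expR_sum -big_split /=; apply: eq_bigr => i _.
rewrite !normal_pdfE// /normal_fun -[RHS]mulrA -expRD mulmxDr mxE; congr (_ * expR _).
by field.
Qed.

(** The derivative of the log-likelihood at [a] along [v], for measurements
    [y]. *)
Definition score (a v : 'cV[R]_p) (y : m.-tuple R) : R :=
  \sum_(i < m) (tnth y i - (H *m a) i 0) * (H *m v) i 0 / sigma ^+ 2.

Lemma derive_density (y : m.-tuple R) (a v : 'cV[R]_p) :
  'D_v (density H sigma y) a = score a v y * density H sigma y a.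
Proof.
pose c := \sum_(i < m) ((H *m v) i 0) ^+ 2 / (sigma ^+ 2 *+ 2).
pose g (t : R) : R := density H sigma y a * expR (t * score a v y - t ^+ 2 * c).
have gE t : density H sigma y (t *: v + a) = g t.
  have Hv i : (H *m (t *: v)) i 0 = t * (H *m v) i 0 by rewrite -scalemxAr mxE.
  have E1 : \sum_(i < m) (tnth y i - (H *m a) i 0) * (H *m (t *: v)) i 0 / sigma ^+ 2 =
      t * score a v y.
    by rewrite mulr_sumr; apply: eq_bigr => i _; rewrite Hv mulrCA !mulrA.
  have E2 : \sum_(i < m) (H *m (t *: v)) i 0 ^+ 2 / (sigma ^+ 2 *+ 2) = t ^+ 2 * c.
    by rewrite mulr_sumr; apply: eq_bigr => i _; rewrite Hv exprMn mulrA.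
  by rewrite density_shift E1 E2.
have dg := is_derive_expR_quadratic (density H sigma y a) (score a v y) c.
transitivity ('D_1 g 0); last exact: (@derive_val _ _ _ _ _ _ _ dg).
have g0 : density H sigma y a = g 0 by rewrite -gE scale0r add0r.
rewrite /derive; set g1 := fun h => h^-1 *: _; set g2 := fun h => h^-1 *: _.
suff -> : g1 = g2 by [].
by apply/funext => h; rewrite /g1 /g2 /= addr0 [_%:A]mulr1 gE g0.
Qed.
End density_directions.

Section Lfun2.
Context d (T : measurableType d) (R : realType) (P : probability T R).

Lemma sqr_lty_Lfun2 (f : T -> R) : measurable_fun setT f ->
  (\int[P]_x (f x ^+ 2)%:E < +oo)%E -> f \in Lfun P 2%:E.
Proof.
move=> mf foo; rewrite inE; apply/andP; split; rewrite inE//= /finite_norm unlock.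
rewrite poweR_lty//.
under eq_integral do rewrite /= powR_mulrn// real_normK ?num_real//.
by [].
Qed.

End Lfun2.

(** * Moments of linear combinations of the noise *)

Section noise_moments.
Context {R : realType} {m : nat} {d : measure_display} {Omega : measurableType d}
  {P : probability Omega R}.
Variables (sigma : R) (w : 'I_m -> {RV P >-> R}).
Hypotheses (sigma0 : sigma != 0) (iidw : iid_gaussian w sigma).

(** The random variable [u . w]. *)
Definition lincomb (u : 'I_m -> R) (omega : Omega) : R := \sum_(i < m) u i * w i omega.

Lemma measurable_lincomb u : measurable_fun setT (lincomb u).
Proof. by apply: measurable_sum => i; exact: measurable_funM. Qed.

(** The moment generating function of [u . w], obtained by applying
    [density_shift] to the model with [H] the identity matrix: the density with
    parameter [sigma^2 u] integrates to 1. *)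
Lemma noise_mgf u :
  (\int[P]_omega (expR (lincomb u omega))%:E =
   (expR ((\sum_(i < m) u i ^+ 2) * sigma ^+ 2 / 2))%:E)%E.
Proof.
pose g (y : m.-tuple R) := expR (\sum_(i < m) u i * tnth y i).
have mg : measurable_fun setT g.
  apply: measurableT_comp => //; apply: measurable_sum => i.
  apply: measurable_funM => //; exact: measurable_tnth.
pose I1 : 'M[R]_(m, m) := 1%:M.
have zE i : (I1 *m (0 : 'cV[R]_m)) i 0 = 0 by rewrite mulmx0 mxE.
transitivity (\int[P]_omega (g (measurements I1 w 0 omega))%:E)%E.
  apply: eq_integral => omega _; congr (expR _)%:E; apply: eq_bigr => i _.
  by rewrite tnth_mktuple zE add0r.
rewrite (ge0_expectation_measurements I1 sigma0 iidw 0 (g := EFin \o g)); last 2 first.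
- exact/measurable_EFinP.
- by move=> y; rewrite lee_fin expR_ge0.
pose v : 'cV[R]_m := \col_i (sigma ^+ 2 * u i).
have vE i : (I1 *m v) i 0 = sigma ^+ 2 * u i by rewrite mul1mx mxE.
set K := expR _.
transitivity (\int[lebesgue_tuple m]_y (K%:E * (density I1 sigma y (v + 0))%:E))%E.
  apply: eq_integral => y _; rewrite /= -!EFinM density_shift//; congr _%:E.
  rewrite [LHS]mulrC [RHS]mulrCA -expRD; congr (_ * expR _).
  rewrite mulr_suml mulr_suml -sumrB -big_split /=; apply: eq_bigr => i _.
  by rewrite zE vE; field.
rewrite ge0_integralZl//.
- by rewrite integral_density mule1.
- by apply/measurable_EFinP; exact: measurable_density.
- by move=> y _; rewrite lee_fin density_ge0.
- by rewrite lee_fin expR_ge0.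
Qed.

Let K u := (\sum_(i < m) u i ^+ 2) * sigma ^+ 2.

Let K0 u : 0 <= K u.
Proof. by rewrite mulr_ge0 ?sqr_ge0// sumr_ge0// => i _; exact: sqr_ge0. Qed.

Let mgf u (t : R) :
  (\int[P]_omega (expR (t * lincomb u omega))%:E = (expR (t ^+ 2 * K u / 2))%:E)%E.
Proof.
transitivity (\int[P]_omega (expR (lincomb (fun i => t * u i) omega))%:E)%E.
  apply: eq_integral => omega _; rewrite /lincomb mulr_sumr.
  by congr (expR _)%:E; apply: eq_bigr => i _; rewrite mulrA.
have E : \sum_(i < m) (t * u i) ^+ 2 = t ^+ 2 * \sum_(i < m) u i ^+ 2.
  by rewrite mulr_sumr; apply: eq_bigr => i _; rewrite exprMn.
by rewrite noise_mgf E /K !mulrA.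
Qed.

Let integrable_exp u (t : R) :
  P.-integrable setT (fun omega => (expR (t * lincomb u omega))%:E).
Proof.
apply/integrableP; split.
  apply/measurable_EFinP; apply: measurableT_comp => //.
  by apply: measurable_funM => //; exact: measurable_lincomb.
under eq_integral do rewrite /= ger0_norm ?expR_ge0//.
by rewrite mgf ltry.
Qed.

Let integrable_sqr u : P.-integrable setT (fun omega => (lincomb u omega ^+ 2)%:E).
Proof.
apply: (@le_integrable _ _ _ P setT measurableT _ (fun omega =>
   (expR (1 * lincomb u omega))%:E + (expR (-1 * lincomb u omega))%:E)%E).
- apply/measurable_EFinP; apply: measurable_funX; exact: measurable_lincomb.
- move=> omega _; rewrite mul1r mulN1r -EFinD !abse_EFin lee_fin.
  rewrite !ger0_norm ?sqr_ge0 ?addr_ge0 ?expR_ge0//.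
  by have := sqr_le_expRD (lincomb u omega); lra.
- by apply: integrableD => //; exact: integrable_exp.
Qed.

Lemma lincomb_Lfun2 u : lincomb u \in Lfun P 2%:E.
Proof.
apply: sqr_lty_Lfun2; first exact: measurable_lincomb.
have /integrableP[_] := integrable_sqr u.
by under eq_integral do rewrite /= ger0_norm ?sqr_ge0//.
Qed.

Let integrable_lincomb u : P.-integrable setT (EFin \o lincomb u).
Proof.
apply/Lfun1_integrable/Lfun_subset12; last exact: lincomb_Lfun2.
exact: fin_num_measure.
Qed.

(** The mean of [cosh(t u . w)] is known and bounds that of
    [1 + (t u . w)^2 / 2]. *)
Lemma noise_second_moment_le u :
  ('E_P[lincomb u ^+ 2] <= ((\sum_(i < m) u i ^+ 2) * sigma ^+ 2)%:E)%E.
Proof.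
rewrite unlock.
have Efin : (\int[P]_omega (lincomb u omega ^+ 2)%:E)%E \is a fin_num.
  by apply: integrable_fin_num => //; exact: integrable_sqr.
rewrite -[leLHS](fineK Efin) lee_fin; apply: second_moment_le; first exact: K0.
move=> t; rewrite -lee_fin EFinM fineK// -integralZl//.
have -> : (2 * (expR (t ^+ 2 * K u / 2) - 1))%:E =
    (\int[P]_omega ((expR (t * lincomb u omega))%:E +
        (expR (- t * lincomb u omega))%:E - 2%:E))%E.
  rewrite integralB//; last 2 first.
  - by apply: integrableD => //; exact: integrable_exp.
  - exact: finite_measure_integrable_cst.
  rewrite integralD//; [|exact: integrable_exp..].
  rewrite !mgf sqrrN integral_cst//= probability_setT mule1 -EFinD.
  by congr _%:E; ring.
apply: le_integral => //.
- exact: integrableZl.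
- apply: integrableB => //; first by apply: integrableD => //; exact: integrable_exp.
  exact: finite_measure_integrable_cst.
- move=> omega _; rewrite -EFinM -EFinD lee_fin mulNr.
  by have := sqr_le_expRD (t * lincomb u omega); rewrite exprMn; lra.
Qed.

(** [1 + z <= e^z] bounds the means of [t u . w] for all [t] and [u]. *)
Lemma noise_mean u : ('E_P[lincomb u] = 0)%E.
Proof.
have Efin v : (\int[P]_omega (lincomb v omega)%:E)%E \is a fin_num.
  by apply: integrable_fin_num => //; exact: integrable_lincomb.
have le0 v : (\int[P]_omega (lincomb v omega)%:E <= 0)%E.
  rewrite -[leLHS](fineK (Efin v)) lee_fin.
  apply: (@first_moment_le0 _ _ (K v)); first exact: K0.
  move=> t; rewrite -lee_fin EFinM fineK// -integralZl//; last exact: integrable_lincomb.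
  have -> : (expR (t ^+ 2 * K v / 2) - 1)%:E =
      (\int[P]_omega ((expR (t * lincomb v omega))%:E - 1%:E))%E.
    rewrite integralB//; last exact: finite_measure_integrable_cst.
    by rewrite mgf integral_cst//= probability_setT mule1.
  apply: le_integral => //.
  - by apply: integrableZl => //; exact: integrable_lincomb.
  - apply: integrableB => //.
    exact: finite_measure_integrable_cst.
  - move=> omega _; rewrite -EFinM lee_fin.
    by have := expR_ge1Dx (t * lincomb v omega); lra.
have opp : (\int[P]_omega (lincomb (fun i => - u i) omega)%:E =
    (-1)%:E * \int[P]_omega (lincomb u omega)%:E)%E.
  rewrite -integralZl//; last exact: integrable_lincomb.
  apply: eq_integral => omega _; rewrite -EFinM /lincomb mulr_sumr.
  by congr _%:E; apply: eq_bigr => i _; ring.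
rewrite unlock -(fineK (Efin u)); congr _%:E; apply/eqP.
rewrite eq_le -!lee_fin fineK// le0/=.
by have := le0 (fun i => - u i); rewrite opp -(fineK (Efin u)) -EFinM !lee_fin; lra.
Qed.

End noise_moments.

(** * Covariances of linear combinations, and matrices *)

Section covariance_lincomb.
Context d (T : measurableType d) (R : realType) (P : probability T R).

Lemma Lfun2_lincomb n (a : 'I_n -> R) (Y : 'I_n -> T -> R) :
  (forall i, Y i \in Lfun P 2%:E) ->
  (fun x => \sum_(i < n) a i * Y i x) \in Lfun P 2%:E.
Proof.
elim: n a Y => [|n IH] a Y Y2.
  rewrite (_ : (fun _ => _) = cst 0) ?Lfun_cst//.
  by apply/funext => x; rewrite big_ord0.
rewrite (_ : (fun _ => _) = (a ord0 \o* Y ord0) \+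
    (fun x => \sum_(i < n) a (lift ord0 i) * Y (lift ord0 i) x)); last first.
  by apply/funext => x /=; rewrite big_ord_recl mulrC.
have h1 : a ord0 \o* Y ord0 \in Lfun P 2%:E by rewrite Lfun_scale ?ler1n.
have h2 := IH (fun i => a (lift ord0 i)) _ (fun i => Y2 (lift ord0 i)).
by rewrite rpredD// lee1n.
Qed.

Lemma covariance_lincombl n (a : 'I_n -> R) (Y : 'I_n -> T -> R) (Z : T -> R) :
  (forall i, Y i \in Lfun P 2%:E) -> Z \in Lfun P 2%:E ->
  covariance P (fun x => \sum_(i < n) a i * Y i x) Z =
  (\sum_(i < n) a i * fine (covariance P (Y i) Z))%:E.
Proof.
move=> Y2 Z2; elim: n a Y Y2 => [|n IH] a Y Y2.
  rewrite big_ord0 (_ : (fun _ => _) = cst 0) ?covariance_cst_l//.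
  by apply/funext => x; rewrite big_ord0.
have Pfin : P setT \is a fin_num := fin_num_measure P _ measurableT.
have Y1 := Lfun_subset12 Pfin (Y2 ord0).
have Z1 := Lfun_subset12 Pfin Z2.
have YZ1 := Lfun2_mul_Lfun1 (Y2 ord0) Z2.
have := covarianceDl (X := a ord0 \o* Y ord0)
    (Y := fun x => \sum_(i < n) a (lift ord0 i) * Y (lift ord0 i) x) _ _ Z2.
rewrite (_ : _ \+ _ = (fun x => \sum_(i < n.+1) a i * Y i x)); last first.
  by apply/funext => x /=; rewrite big_ord_recl mulrC.
move=> ->; last 2 first.
- by rewrite Lfun_scale ?ler1n.
- exact: Lfun2_lincomb.
rewrite (IH (fun i => a (lift ord0 i)) (fun i => Y (lift ord0 i)))//.
rewrite covarianceZl// [in RHS]big_ord_recl EFinD EFinM fineK//.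
by rewrite covariance_fin_num.
Qed.

Lemma covariance_lincombr n (a : 'I_n -> R) (Y : 'I_n -> T -> R) (Z : T -> R) :
  (forall i, Y i \in Lfun P 2%:E) -> Z \in Lfun P 2%:E ->
  covariance P Z (fun x => \sum_(i < n) a i * Y i x) =
  (\sum_(i < n) a i * fine (covariance P Z (Y i)))%:E.
Proof.
move=> Y2 Z2; rewrite covarianceC covariance_lincombl//.
by under eq_bigr do rewrite covarianceC.
Qed.

(** The covariance is the integral of a square, after centring at a constant
    that is well defined even before [X] is known to be integrable. *)
Lemma Lfun2_variance (X : T -> R) : measurable_fun setT X ->
  covariance P X X \is a fin_num -> X \in Lfun P 2%:E.
Proof.
move=> mX Xfin; set c := fine ('E_P[X])%E.
have h1 : (X \- cst c) \in Lfun P 2%:E.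
  apply: sqr_lty_Lfun2; first exact: measurable_funB.
  move: Xfin; rewrite covariance.unlock -/c expectation.unlock => Xfin.
  by rewrite ltey_eq; apply/orP; left.
have h2 : cst c \in Lfun P 2%:E by exact: Lfun_cst.
have -> : X = (X \- cst c) \+ cst c by apply/funext => x /=; rewrite subrK.
by rewrite rpredD// lee1n.
Qed.

End covariance_lincomb.

Section matrices.
Context {R : realType}.

Lemma quad_form_sum n (M : 'M[R]_n) (v : 'cV[R]_n) :
  (v^T *m M *m v) 0 0 = \sum_(i < n) v i 0 * (\sum_(j < n) v j 0 * M i j).
Proof.
rewrite -mulmxA mxE; apply: eq_bigr => i _; rewrite !mxE; congr (_ * _).
by apply: eq_bigr => j _; rewrite mulrC.
Qed.

(** The bound [2 v^T C u - c |u|^2 <= v^T S v], optimised over the [u] in the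
    range of [M]: the hypotheses on [X] make [M X M^T] an orthogonal projection,
    and the optimal [u] is the projection of [c^-1 C^T v]. *)
Lemma loewner_ge_projection (p m k : nat) (S : 'M[R]_p) (C : 'M[R]_(p, m))
    (M : 'M[R]_(m, k)) (X : 'M[R]_k) (c : R) :
  0 < c -> S^T = S -> X^T = X -> X *m (M^T *m M) *m X = X ->
  (forall (v : 'cV[R]_p) (u : 'cV[R]_m),
    2 * (v^T *m C *m u) 0 0 - c * (u^T *m u) 0 0 <= (v^T *m S *m v) 0 0) ->
  loewner_ge S (c^-1 *: (C *m M *m X *m (C *m M)^T)).
Proof.
move=> c0 sS sX XMX hS.
have sN : (C *m M *m X *m (C *m M)^T)^T = C *m M *m X *m (C *m M)^T.
  by rewrite trmx_mul trmxK trmx_mul sX mulmxA.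
split; first by rewrite raddfB/= sS linearZ/= sN.
move=> v; rewrite mulmxBr mulmxBl.
pose u := c^-1 *: (M *m X *m (C *m M)^T *m v).
have := hS v u.
set q := (v^T *m (C *m M *m X *m (C *m M)^T) *m v) 0 0.
have -> : (v^T *m C *m u) 0 0 = c^-1 * q.
  by rewrite /u -scalemxAr mxE; congr (_ * _); rewrite /q !mulmxA.
have -> : (u^T *m u) 0 0 = c^-1 * (c^-1 * q).
  have -> : u^T = c^-1 *: (M *m X *m (C *m M)^T *m v)^T by rewrite /u linearZ.
  rewrite /u -scalemxAl -scalemxAr mxE [X in _ * X = _]mxE; congr (_ * (_ * _)).
  rewrite /q !trmx_mul !trmxK sX -!mulmxA.
  suff -> : X *m (M^T *m (M *m (X *m (M^T *m (C^T *m v))))) =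
            X *m (M^T *m (C^T *m v)) by [].
  by rewrite -[in RHS]XMX !mulmxA.
rewrite [c * (_ * _)]mulrA divff ?gt_eqF// mul1r => h.
rewrite mxE [X in _ + X]mxE -scalemxAr -scalemxAl [X in _ - X]mxE -/q.
by lra.
Qed.

Lemma free_columns (m p : nat) (H : 'M[R]_(m, p)) (A : {set 'I_p}) :
  free [seq col j H | j in A] -> row_free (columns H A)^T.
Proof.
move=> frA; apply: inj_row_free => v v0.
have /freeP fr : free (image_tuple (fun j => col j H) A) by exact: frA.
apply/rowP => i; rewrite mxE; apply: (fr (v 0)).
transitivity ((v *m (columns H A)^T)^T); last by rewrite v0 trmx0.
apply/colP => k; rewrite summxE !mxE; apply: eq_bigr => j _.
by rewrite nth_image !mxE.
Qed.

Lemma spark_columns_unit (m p s : nat) (H : 'M[R]_(m, p)) (A : {set 'I_p}) :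
  ((2 * s)%:R%:E < spark H)%E -> (#|A| <= s)%N ->
  (columns H A)^T *m columns H A \in unitmx.
Proof.
move=> hs As; rewrite -[X in _ *m X]trmxK; apply: gram_unit; apply: free_columns.
apply: contraTT hs => nfree; rewrite -leNgt.
apply: (@le_trans _ _ (#|A|%:R%:E)).
  apply: ereal_inf_lbound; exists #|A| => //.
  by exists A.
by rewrite lee_fin ler_nat (leq_trans As)// leq_pmull.
Qed.

Lemma pseudoinverse_sym (n : nat) (A : 'M[R]_n) : A^T = A ->
  (pseudoinverse A)^T = pseudoinverse A.
Proof.
move=> sA; have [a b c e] := pseudoinverseP A.
apply: (@penrose_inj _ _ _ A); last exact: pseudoinverseP.
have PA : A *m (pseudoinverse A)^T = pseudoinverse A *m A.
  by rewrite -{1}sA -trmx_mul e.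
have AP : (pseudoinverse A)^T *m A = A *m pseudoinverse A.
  by rewrite -{2}sA -trmx_mul c.
split; rewrite ?PA ?AP//.
- by have := congr1 trmx a; rewrite !trmx_mul sA mulmxA PA.
- by have := congr1 trmx b; rewrite !trmx_mul sA mulmxA AP.
Qed.

Lemma mulmx_columns1 (m p : nat) (H : 'M[R]_(m, p)) (A : {set 'I_p}) :
  H *m columns 1%:M A = columns H A.
Proof. by rewrite /columns mulmx_colsub mulmx1. Qed.

End matrices.

(** * The bias gradient and the covariance bound *)

Lemma derive_coord {R : realType} (n : nat) (a v : 'cV[R]_n) (i : 'I_n) :
  'D_v (fun b : 'cV[R]_n => b i 0 : R) a = v i 0.
Proof.
have @f : {linear 'cV[R]_n -> R}.
  by exists (fun N : 'cV[R]_n => N i 0); do 2![eexists]; do ?[constructor];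
     rewrite ?mxE// => ? *; rewrite ?mxE//; move=> ?; rewrite !mxE.
rewrite deriveE; last exact: differentiable_coord.
by rewrite (_ : (fun _ => _) = f)// diff_lin//; exact: coord_continuous.
Qed.

Section information_inequality.
Context {R : realType} {m p : nat} {d : measure_display} {Omega : measurableType d}
  {P : probability Omega R}.
Variables (H : 'M[R]_(m, p)) (sigma : R) (w : 'I_m -> {RV P >-> R})
  (est : {mfun m.-tuple R >-> p.-tuple R}) (a : 'cV[R]_p).
Hypotheses (sigma0 : sigma != 0) (iidw : iid_gaussian w sigma).

Lemma measurable_estimate b i : measurable_fun setT (estimate H w est b i).
Proof.
apply: (measurableT_comp (measurable_tnth i)).
apply: (measurableT_comp (measurable_funPT est)).
exact: measurable_measurements.
Qed.

Lemma noise_Lfun2 k : (w k : Omega -> R) \in Lfun P 2%:E.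
Proof.
have -> : (w k : Omega -> R) = lincomb w (fun i => (i == k)%:R).
  apply/funext => omega; rewrite /lincomb (bigD1 k)//= eqxx mul1r big1 ?addr0// => i.
  by move=> /negbTE ->; rewrite mul0r.
exact: (lincomb_Lfun2 sigma0).
Qed.

(** The integral is the mean that [regular_estimator] differentiates. *)
Lemma fine_expectation_estimate b i :
  fine ('E_P[estimate H w est b i])%E =
  \int[lebesgue_tuple m]_y (tnth (est y) i * density H sigma y b).
Proof.
rewrite /Rintegral unlock; congr fine.
rewrite -(expectation_measurements H sigma0 iidw b (g := fun y => tnth (est y) i))//.
exact: (measurableT_comp (measurable_tnth i) (measurable_funPT est)).
Qed.

Lemma score_measurements v omega :
  score H sigma a v (measurements H w a omega) =
  lincomb w (fun k => (H *m v) k 0 / sigma ^+ 2) omega.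
Proof.
by apply: eq_bigr => k _; rewrite tnth_mktuple addrAC subrr add0r [RHS]mulrC mulrA.
Qed.

Hypotheses (fv : finite_variance H w est a) (reg : regular_estimator H sigma est a).

Lemma estimate_Lfun2 i : estimate H w est a i \in Lfun P 2%:E.
Proof. by apply: Lfun2_variance; [exact: measurable_estimate|exact: fv]. Qed.

(** The matrix of covariances of the estimate at [a] with the noise. *)
Definition noise_cov : 'M[R]_(p, m) :=
  \matrix_(i, k) fine (covariance P (estimate H w est a i) (w k)).

(** The derivative of the mean is the mean of the estimate times the score, and
    the score at the measurements is a linear combination of the noise. *)
Lemma bias_gradient_noise_cov :
  1%:M + bias_gradient H w est a = (sigma ^+ 2)^-1 *: (noise_cov *m H).
Proof.
apply/matrixP => i j; rewrite !mxE.
pose e : 'cV[R]_p := delta_mx j 0.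
have [dmean dmeanE] := reg i j.
set mean := fun b : 'cV[R]_p => _ in dmean dmeanE.
have -> : (fun b => bias H w est b i 0 : R) = mean - (fun b : 'cV[R]_p => b i 0).
  by apply/funext => b; rewrite !mxE fine_expectation_estimate.
have dcoord : derivable (fun b : 'cV[R]_p => b i 0 : R) a e.
  exact/diff_derivable/differentiable_coord.
rewrite deriveB// dmeanE.
have -> : 'D_e (fun b : 'cV[R]_p => b i 0 : R) a = (i == j)%:R.
  by rewrite derive_coord mxE eqxx andbT.
rewrite addrC subrK.
transitivity (fine ('E_P[estimate H w est a i *
    lincomb w (fun k => (H k j / sigma ^+ 2)%R)])%E).
  rewrite unlock /Rintegral; congr fine.
  transitivity (\int[P]_omega ((fun y => tnth (est y) i * score H sigma a e y)
      (measurements H w a omega))%:E)%E.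
    rewrite (expectation_measurements H sigma0 iidw a
      (g := fun y => tnth (est y) i * score H sigma a e y)).
      by apply: eq_integral => y _; rewrite derive_density// mulrA.
    apply: measurable_funM.
      exact: (measurableT_comp (measurable_tnth i) (measurable_funPT est)).
    apply: measurable_sum => k; apply: measurable_funM => //.
    apply: measurable_funM => //; apply: measurable_funB => //.
    exact: measurable_tnth.
  apply: eq_integral => omega _; rewrite score_measurements; congr (_ * lincomb w _ omega)%:E.
  by apply/funext => k; rewrite /e -colE mxE.
set u := fun k => _.
have X2 := estimate_Lfun2 i.
have Y2 := lincomb_Lfun2 sigma0 iidw u.
have Pfin : P setT \is a fin_num := fin_num_measure P _ measurableT.
have := covarianceE (Lfun_subset12 Pfin X2) (Lfun_subset12 Pfin Y2)
  (Lfun2_mul_Lfun1 X2 Y2).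
rewrite (noise_mean sigma0)// mule0 sube0 => <-.
rewrite covariance_lincombr//; last exact: noise_Lfun2.
rewrite mulr_sumr; apply: eq_bigr => k _; rewrite /u !mxE.
by rewrite mulrC mulrA mulrC.
Qed.

(** The variance of [v . X - u . w] is nonnegative. *)
Lemma covariance_noise_bound (v : 'cV[R]_p) (u : 'cV[R]_m) :
  2 * (v^T *m noise_cov *m u) 0 0 - sigma ^+ 2 * (u^T *m u) 0 0 <=
  (v^T *m cov_mx H w est a *m v) 0 0.
Proof.
pose X omega := \sum_(i < p) v i 0 * estimate H w est a i omega.
pose Y := lincomb w (fun k => u k 0).
have X2 : X \in Lfun P 2%:E by apply: Lfun2_lincomb => i; exact: estimate_Lfun2.
have Y2 : Y \in Lfun P 2%:E by exact: (lincomb_Lfun2 sigma0).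
have XXE : covariance P X X = ((v^T *m cov_mx H w est a *m v) 0 0)%:E.
  rewrite covariance_lincombl//; last exact: estimate_Lfun2.
  rewrite quad_form_sum; congr _%:E; apply: eq_bigr => i _; congr (_ * _).
  rewrite covariance_lincombr//=; [|exact: estimate_Lfun2..].
  by apply: eq_bigr => j _; rewrite mxE.
have XYE : covariance P X Y = ((v^T *m noise_cov *m u) 0 0)%:E.
  rewrite covariance_lincombl//; last exact: estimate_Lfun2.
  rewrite -mulmxA mxE; congr _%:E; apply: eq_bigr => i _; rewrite !mxE; congr (_ * _).
  rewrite covariance_lincombr//=; [|exact: noise_Lfun2|exact: estimate_Lfun2].
  by apply: eq_bigr => j _; rewrite mxE mulrC.
have YYE : (covariance P Y Y <= (sigma ^+ 2 * (u^T *m u) 0 0)%:E)%E.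
  have := varianceE Y2; rewrite /variance => ->.
  rewrite (noise_mean sigma0)// expe2 mul0e sube0.
  apply: (le_trans (noise_second_moment_le sigma0 iidw _)).
  rewrite lee_fin mulrC mxE ler_wpM2l ?sqr_ge0// ler_sum// => k _.
  by rewrite mxE expr2.
have := variance_ge0 P (X \- Y).
rewrite varianceB// [in X in (X + _ - _)%E]/variance XXE XYE => h0.
have : (0 <= ((v^T *m cov_mx H w est a *m v) 0 0)%:E +
    (sigma ^+ 2 * (u^T *m u) 0 0)%:E -
    2%:E * ((v^T *m noise_cov *m u) 0 0)%:E)%E.
  by apply: (le_trans h0); rewrite leeB// leeD2l.
by rewrite -EFinM -EFinD lee_fin; lra.
Qed.

Lemma cov_mx_sym : (cov_mx H w est a)^T = cov_mx H w est a.
Proof. by apply/matrixP => i j; rewrite !mxE covarianceC. Qed.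

End information_inequality.

Unset Implicit Arguments.

Theorem theorem2 (R : realType) (m p s : nat) (H : 'M[R]_(m, p))
    (alpha0 : 'cV[R]_p) (sigma : R)
    (d : measure_display) (Omega : measurableType d) (P : probability Omega R)
    (w : 'I_m -> {RV P >-> R}) (est : {mfun m.-tuple R >-> p.-tuple R}) :
  (s < p)%N ->
  ((2 * s)%:R%:E < spark H)%E ->
  sparse_vectors s alpha0 ->
  0 < sigma ->
  iid_gaussian w sigma ->
  finite_variance H w est alpha0 ->
  regular_estimator H sigma est alpha0 ->
  ((norm0 alpha0 < s)%N ->
     null_space H `<=` null_space (1%:M + bias_gradient H w est alpha0))
  /\
  (forall B : 'M[R]_p,
     ((norm0 alpha0 < s)%N ->
        let U : 'M[R]_p := 1%:M in
        bias_gradient H w est alpha0 *m U = B *m U ->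
        loewner_ge (cov_mx H w est alpha0)
          (sigma ^+ 2 *:
             ((1%:M + B) *m pseudoinverse (H^T *m H) *m (1%:M + B^T))))
     /\
     (norm0 alpha0 = s ->
        let U := columns 1%:M (supp alpha0) in
        let H_alpha0 := columns H (supp alpha0) in
        bias_gradient H w est alpha0 *m U = B *m U ->
        loewner_ge (cov_mx H w est alpha0)
          (sigma ^+ 2 *:
             ((U + B *m U) *m invmx (H_alpha0^T *m H_alpha0)
                *m (U + B *m U)^T)))).
Proof.
move=> _ hspark a0s sigma_gt0 iidw fv reg.
have sigma0 : sigma != 0 by rewrite gt_eqF.
have s2 : 0 < sigma ^+ 2 by rewrite exprn_gt0.
have IBE := bias_gradient_noise_cov sigma0 iidw fv reg.
have bound := covariance_noise_bound sigma0 iidw fv.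
have sS := @cov_mx_sym _ _ _ _ _ _ H w est alpha0.
set C := noise_cov H w est alpha0 in IBE bound.
split.
  move=> _ v /= Hv; rewrite /null_space/= IBE -scalemxAl -mulmxA.
  by rewrite (Hv : H *m v = 0) mulmx0 scaler0.
(* the bound of [loewner_ge_projection], written as in the two inequalities *)
have scale (k : nat) (M : 'M[R]_(m, k)) (X : 'M[R]_k) :
    (sigma ^+ 2)^-1 *: (C *m M *m X *m (C *m M)^T) =
    sigma ^+ 2 *: (((sigma ^+ 2)^-1 *: (C *m M)) *m X *m
      ((sigma ^+ 2)^-1 *: (C *m M))^T).
  rewrite [((_ *: (C *m M))^T)]linearZ/= -!scalemxAl -scalemxAr !scalerA.
  by congr (_ *: _); field.
move=> B; split.
  move=> _ U; rewrite !mulmx1 => BE.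
  have -> : 1%:M + B^T = (1%:M + B)^T by rewrite linearD/= trmx1.
  rewrite -BE IBE -scale.
  have [_ XGX _ _] := pseudoinverseP (H^T *m H).
  apply: loewner_ge_projection => //.
  by apply: pseudoinverse_sym; rewrite trmx_mul trmxK.
move=> a0E U H0 BU.
have -> : U + B *m U = (sigma ^+ 2)^-1 *: (C *m H0).
  by rewrite -BU -[X in X + _]mul1mx -mulmxDl IBE -scalemxAl -mulmxA mulmx_columns1.
rewrite -scale.
have Gu : H0^T *m H0 \in unitmx.
  by apply: (spark_columns_unit hspark); rewrite -a0E.
apply: loewner_ge_projection => //.
  by rewrite trmx_inv trmx_mul trmxK.
by rewrite mulVmx// mul1mx.
Qed.
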